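(* If $x^{\star}$ is a global minimizer of the problem $\min\{f(x)/g(x)+h(x): x\in\Omega\cap\mathcal{C}\}$, then $(x^{\star},1/g(x^{\star}))$ is a global min-max point of the problem $\min_{x}\max_{c\in\mathbb{R}}\widetilde{F}(x,c)$. Conversely, if $(x^{\star},c_{\star})$ is a global min-max point of $\min_{x}\max_{c\in\mathbb{R}}\widetilde{F}(x,c)$, then $x^{\star}$ is a global minimizer of $\min\{f(x)/g(x)+h(x): x\in\Omega\cap\mathcal{C}\}$.
   Context: Setting: $f,g:\mathbb{R}^n\to[0,+\infty)$ and $h:\mathbb{R}^n\to\mathbb{R}$ are proper closed (lower semicontinuous), $\mathcal{C}\subseteq\mathbb{R}^n$ is closed, $\Omega:=\{x\in\mathbb{R}^n: g(x)\neq 0\}$, and $\mathcal{C}\cap\Omega\neq\emptyset$. Standing assumptions: (i) $f$ is locally Lipschitz continuous on $\Omega$; (ii) $g$ is convex on $\mathbb{R}^n$; (iii) $h=h_1-h_2$, where $h_1:\mathbb{R}^n\to\mathbb{R}$ is locally Lipschitz differentiable around each $x\in\Omega$ (each $x\in\Omega$ has a ball on which $h_1$ is continuously differentiable with Lipschitz gradient) and $h_2:\mathbb{R}^n\to\mathbb{R}$ is convex. Min-max objective: $\widetilde{F}(x,c):=2cf(x)-c^2f(x)g(x)+h(x)+\iota_{\Omega\cap\mathcal{C}}(x)$ for $(x,c)\in\mathbb{R}^n\times\mathbb{R}$, where $\iota_{\Omega\cap\mathcal{C}}$ equals $0$ on $\Omega\cap\mathcal{C}$ and $+\infty$ elsewhere;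 thus the feasible set for $x$ is $\Omega\cap\mathcal{C}$ and for $c$ is $\mathbb{R}$. Global min-max point: $(x^{\star},c_{\star})\in(\Omega\cap\mathcal{C})\times\mathbb{R}$ is a global min-max point if $c_{\star}$ is a global maximizer of $\widetilde{F}(x^{\star},\cdot)$ over $\mathbb{R}$ and $x^{\star}$ is a global minimizer over $\Omega\cap\mathcal{C}$ of the function $x\mapsto\max_{c\in\mathbb{R}}\widetilde{F}(x,c)$. *)

(* Defs.v *)
From HB Require Import structures.
From mathcomp Require Export all_boot all_order all_algebra.
From mathcomp Require Export all_classical all_reals all_analysis.
Export Order.TTheory GRing.Theory Num.Theory.
Export numFieldNormedType.Exports.

Set Implicit Arguments.
Unset Strict Implicit.
Unset Printing Implicit Defensive.

Local Open Scope classical_set_scope.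
Local Open Scope ring_scope.

Definition global_minimizer (T : Type) (d : Order.disp_t) (U : porderType d)
    (S : set T) (phi : T -> U) (x : T) : Prop :=
  S x /\ forall y, S y -> (phi x <= phi y)%O.

Definition global_maximizer (T : Type) (d : Order.disp_t) (U : porderType d)
    (S : set T) (phi : T -> U) (x : T) : Prop :=
  S x /\ forall y, S y -> (phi y <= phi x)%O.

(* The value max_c F(x, c) is taken as a supremum in \bar R, so that it is
   defined for every F and x; it is the maximum whenever one exists. *)
Definition inner_max (T : Type) (R : realType) (F : T -> R -> \bar R) (x : T)
    : \bar R :=
  ereal_sup [set F x c | c in [set: R]].

Definition global_minmax_point (T : Type) (R : realType) (S : set T)
    (F : T -> R -> \bar R) (x : T) (c : R) : Prop :=
  [/\ S x,
      global_maximizer [set: R] (F x) c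
    & global_minimizer S (inner_max F) x].

(* The indicator function of convex analysis, not the 0/1-valued one. *)
Definition iota_set (T : Type) (R : realType) (A : set T) (x : T) : \bar R :=
  if x \in A then 0%E else +oo%E.

Section euclidean_space.
Context (R : realType) (n : nat).
(* 'rV[R]_n carries the max norm; the balls and Lipschitz conditions below only
   depend on the norm up to equivalence. *)
Implicit Types (f g h : 'rV[R]_n -> R) (C : set 'rV[R]_n).

Definition Omega g : set 'rV[R]_n := [set x | g x != 0].

Definition ratio_objective f g h (x : 'rV[R]_n) : R := f x / g x + h x.

Definition minmax_objective f g h C (x : 'rV[R]_n) (c : R) : \bar R :=
  ((2 * c * f x - c ^+ 2 * f x * g x + h x)%:E
    + iota_set R (Omega g `&` C) x)%E.

Definition locally_lipschitz_on (A : set 'rV[R]_n) f : Prop :=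
  forall x, A x ->
    exists2 r : R, 0 < r & [lipschitz (f y : R^o) | y in ball x r `&` A].

Definition gradient f (x : 'rV[R]_n) : 'rV[R]_n :=
  \row_(i < n) 'D_(delta_mx 0 i) (f : 'rV[R]_n -> R^o) x.

Definition locally_lipschitz_differentiable_around f (x : 'rV[R]_n) : Prop :=
  exists2 r : R, 0 < r &
    [/\ forall y, ball x r y -> differentiable (f : 'rV[R]_n -> R^o) y,
        {within ball x r, continuous (gradient f)}
      & [lipschitz gradient f y | y in ball x r]].

End euclidean_space.

(* Main.v *)
(* For fixed feasible x, completing the square in c shows that the min-max
   objective is the ratio objective minus the nonnegative square
   f / g * (1 - c g)^2. Hence its maximum over c is attained at c = 1 / g and
   equals the ratio objective, so both problems minimize the same function. *)

Require Import Defs.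
From mathcomp Require Import ring.

Local Open Scope classical_set_scope.
Local Open Scope ring_scope.

Section completing_the_square.
Context (R : realType) (n : nat).
Implicit Types (f g h : 'rV[R]_n -> R) (C : set 'rV[R]_n).

Lemma minmax_objectiveE f g h C x c : (Omega g `&` C) x ->
  minmax_objective f g h C x c =
    (ratio_objective f g h x - f x / g x * (1 - c * g x) ^+ 2)%:E.
Proof.
move=> Sx; have gx0 : g x != 0 by case: Sx.
(* Feasibility makes the indicator term 0, leaving an identity between reals; [gx0] lets [field]
   clear the denominators. *)
rewrite /minmax_objective /iota_set mem_set// adde0 /ratio_objective.
by congr (_%:E); field.
Qed.

Lemma minmax_objective_inv f g h C x : (Omega g `&` C) x ->
  minmax_objective f g h C x (1 / g x) = (ratio_objective f g h x)%:E.
Proof.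
move=> Sx; have gx0 : g x != 0 by case: Sx.
by rewrite minmax_objectiveE// divfK// subrr expr0n mulr0 subr0.
Qed.

(** The signs of [f] and [g] make the coefficient [f x / g x] of the subtracted square
    nonnegative. *)
Lemma minmax_objective_le f g h C x c : 0 <= f x -> 0 <= g x ->
  (Omega g `&` C) x ->
  (minmax_objective f g h C x c <= (ratio_objective f g h x)%:E)%E.
Proof.
move=> fx0 gx0 Sx; rewrite minmax_objectiveE// lee_fin gerBl.
by rewrite mulr_ge0 ?divr_ge0 ?sqr_ge0.
Qed.

Lemma inner_max_minmax_objective f g h C x : 0 <= f x -> 0 <= g x ->
  (Omega g `&` C) x ->
  inner_max (minmax_objective f g h C) x = (ratio_objective f g h x)%:E.
Proof.
move=> fx0 gx0 Sx; apply/eqP; rewrite eq_le; apply/andP; split.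
  by apply: ge_ereal_sup => _ [c _ <-]; exact: minmax_objective_le.
(* The upper bound is reached at [1 / g x], where the square vanishes, so the supremum is a
   maximum. *)
by apply: ereal_sup_ubound; exists (1 / g x); rewrite ?minmax_objective_inv.
Qed.

End completing_the_square.

Theorem proposition2 (R : realType) (n : nat)
    (f g h h1 h2 : 'rV[R]_n -> R) (C : set 'rV[R]_n)
    (f_ge0 : forall x, 0 <= f x) (g_ge0 : forall x, 0 <= g x)
    (f_lsc : lower_semicontinuous (EFin \o f))
    (g_lsc : lower_semicontinuous (EFin \o g))
    (h_lsc : lower_semicontinuous (EFin \o h))
    (C_closed : closed C)
    (C_Omega : C `&` Omega g !=set0)
    (f_loclip : locally_lipschitz_on (Omega g) f)
    (g_convex : convex_function [set: 'rV[R]_n] g)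
    (h_diff : forall x, h x = h1 x - h2 x)
    (h1_smooth : forall x, Omega g x ->
       locally_lipschitz_differentiable_around h1 x)
    (h2_convex : convex_function [set: 'rV[R]_n] h2) :
  (forall xs : 'rV[R]_n,
     global_minimizer (Omega g `&` C) (ratio_objective f g h) xs ->
     global_minmax_point (Omega g `&` C) (minmax_objective f g h C)
       xs (1 / g xs)) /\
  (forall (xs : 'rV[R]_n) (cs : R),
     global_minmax_point (Omega g `&` C) (minmax_objective f g h C) xs cs ->
     global_minimizer (Omega g `&` C) (ratio_objective f g h) xs).
Proof.
(* Minimality passes both ways along this equality, since [EFin] preserves and reflects the
   order. *)
have maxE x : (Omega g `&` C) x ->
    inner_max (minmax_objective f g h C) x = (ratio_objective f g h x)%:E.
  by move=> Sx; exact: inner_max_minmax_objective.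
split=> [xs [Sxs xs_min]|xs cs [Sxs _ [_ xs_min]]].
  split=> //; split=> //.
    (* The value at [1 / g xs] is the ratio, which bounds the values at all [c]. *)
    by move=> c _; rewrite minmax_objective_inv// minmax_objective_le.
  by move=> y Sy; rewrite !maxE// lee_fin xs_min.
(* Lifted to [\bar R], the inequality between ratios becomes one between inner maxima. *)
by split=> // y Sy; rewrite -lee_fin -!maxE// xs_min.
Qed.
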